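(* Let $n$ and $k$ be positive integers such that $k \equiv 1, 2 \pmod 4$ and $n \geq k + 2$, or $k \equiv 0, 3 \pmod 4$ and $n \geq k + 3$. Let $|A| = k$, and let $f, g \colon A^n \to B$ be functions that are weakly determined by the order of first occurrence. If $\operatorname{deck} f = \operatorname{deck} g$, then $f \equiv g$.
   Context: $A$ and $B$ are sets with at least two elements. $[n] := \{1,\dots,n\}$, $\binom{[n]}{2}$ denotes the set of all $2$-element subsets of $[n]$, and $\Sigma_n$ is the symmetric group on $[n]$. For $\mathbf{a} \in A^n$ and $\sigma \colon [m] \to [n]$, write $\mathbf{a}\sigma := (a_{\sigma(1)},\dots,a_{\sigma(m)}) \in A^m$. Functions $f, g \colon A^n \to B$ are equivalent, $f \equiv g$, if there is $\sigma \in \Sigma_n$ with $f(\mathbf{a}) = g(\mathbf{a}\sigma)$ for all $\mathbf{a} \in A^n$. For $n \geq 2$, $f \colon A^n \to B$ and $I \in \binom{[n]}{2}$, the identification minor $f_I \colon A^{n-1} \to B$ is given by $f_I(\mathbf{a}) = f(\mathbf{a}\delta_I)$, where $\delta_I \colon [n] \to [n-1]$ is defined by $\delta_I(i) = i$ if $i < \max I$, $\delta_I(i) = \min I$ if $i = \max I$, and $\delta_I(i) = i-1$ if $i > \max I$. The deck of $f$, $\operatorname{deck} f$, is the multiset $\{f_I/{\equiv} : I \in \binom{[n]}{2}\}$ of equivalence classes. Let $A^r_{\neq}$ be the set of $r$-tuples over $A$ with pairwise distinct entries and $A^\sharp := \bigcup_{r \geq 1} A^r_{\neq}$. The map $\operatorname{ofo}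 \colon \bigcup_{n \geq 1} A^n \to A^\sharp$ sends a tuple $\mathbf{a}$ to the tuple listing the distinct elements occurring in $\mathbf{a}$ in the order of their first occurrence. A function $f \colon A^n \to B$ is weakly determined by the order of first occurrence if there exist $f^* \colon A^\sharp \to B$ and $\sigma \in \Sigma_n$ such that $f(\mathbf{a}) = f^*(\operatorname{ofo}(\mathbf{a}\sigma))$ for all $\mathbf{a} \in A^n$. *)

(* Defs.v *)
From mathcomp Require Import all_boot all_order all_fingroup.
From mathcomp Require Import finmap multiset.
From mathcomp Require Import boolp classical_sets.

Set Implicit Arguments.
Unset Strict Implicit.
Unset Printing Implicit Defensive.

(* The index set [n] = {1, ..., n} is 'I_n = {0, ..., n-1}; all indices below
   are shifted by one accordingly. *)

Definition tuple_map (A : Type) (m n : nat) (a : n.-tuple A)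
  (sigma : 'I_m -> 'I_n) : m.-tuple A :=
  [tuple tnth a (sigma i) | i < m].

Definition fun_equiv (A B : Type) (n : nat) (f g : n.-tuple A -> B) : Prop :=
  exists sigma : 'S_n, forall a : n.-tuple A, f a = g (tuple_map a sigma).

Definition pairset (n : nat) : Type := {I : {set 'I_n} | #|I| == 2}.

Definition pair_max (n : nat) (I : pairset n) : nat :=
  \max_(i in val I) (i : nat).

(* The neutral element n is an upper bound of 'I_n. *)
Definition pair_min (n : nat) (I : pairset n) : nat :=
  \big[minn/n]_(i in val I) (i : nat).

Definition delta_nat (n : nat) (I : pairset n) (i : nat) : nat :=
  if i < pair_max I then i
  else if i == pair_max I then pair_min I
  else i.-1.

Lemma pair_minmaxP (n : nat) (I : pairset n) :
  exists i j : 'I_n,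
    [/\ val I = [set i; j], i < j, pair_min I = i & pair_max I = j].
Proof.
suff H (x y : 'I_n) : val I = [set x; y] -> x < y ->
    pair_min I = x /\ pair_max I = y.
  have /cards2P [x [y [xy E]]] := valP I.
  have [lt_xy|lt_yx|/val_inj eq_xy] := ltngtP x y.
  - by exists x, y; have [] := H _ _ E lt_xy.
  - by exists y, x; rewrite finset.setUC in E; have [] := H _ _ E lt_yx.
  - by rewrite eq_xy eqxx in xy.
move=> E lt_xy; split; last first.
  have xNy : x \notin [set y] by rewrite inE -val_eqE neq_ltn lt_xy.
  rewrite /pair_max E finset.big_setU1 //= big_set1.
  exact/maxn_idPr/ltnW.
apply/eqP; rewrite /pair_min E eqn_leq; apply/andP; split.
  have := mem_index_enum x.
  elim: (index_enum _) => //= z r IHr; rewrite inE big_cons => /predU1P [<-|xr].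
    by rewrite !inE eqxx geq_minl.
  by case: ifP => _; rewrite ?geq_min IHr ?orbT.
elim/big_ind: _ => [|p q xp xq|z]; [exact: ltnW| |].
  by rewrite leq_min xp.
by rewrite !inE => /orP [] /eqP -> //; exact: ltnW.
Qed.

Lemma delta_subproof (n : nat) (I : pairset n) (i : 'I_n) :
  delta_nat I i < n.-1.
Proof.
have [x [y [_ lt_xy mE ME]]] := pair_minmaxP I.
rewrite /delta_nat mE ME.
have le_y : y <= n.-1 by rewrite -ltnS (ltn_predK (ltn_ord y)).
have le_i : i <= n.-1 by rewrite -ltnS (ltn_predK (ltn_ord i)).
have [lt_iy|lt_yi|_] := ltngtP i y.
- exact: leq_trans lt_iy le_y.
- by rewrite (ltn_predK lt_yi).
- exact: leq_trans lt_xy le_y.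
Qed.

Definition delta (n : nat) (I : pairset n) (i : 'I_n) : 'I_n.-1 :=
  Ordinal (delta_subproof I i).

Definition id_minor (A B : Type) (n : nat) (f : n.-tuple A -> B)
  (I : pairset n) : n.-1.-tuple A -> B :=
  fun a => f (tuple_map a (delta I)).

Definition fun_class (A B : Type) (n : nat) (f : n.-tuple A -> B) :
  set (n.-tuple A -> B) := [set g | fun_equiv f g]%classic.

Definition deck (A B : Type) (n : nat) (f : n.-tuple A -> B) :
  {mset set (n.-1.-tuple A -> B)}%mset :=
  seq_mset [seq fun_class (id_minor f J) | J <- enum {: pairset n}].

Definition Asharp (A : eqType) : Type :=
  {s : seq A | (0 < size s) && uniq s}.

(* undup keeps the last occurrence of each element, hence the reversals. *)
Definition ofo_seq (A : eqType) (s : seq A) : seq A := rev (undup (rev s)).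

Lemma ofo_seq_cons (A : eqType) (x : A) (s : seq A) :
  ofo_seq (x :: s) = x :: [seq y <- ofo_seq s | y != x].
Proof. by rewrite /ofo_seq rev_cons undup_rcons rev_rcons filter_rev. Qed.

Lemma ofo_subproof (A : eqType) (n : nat) (n_gt0 : 0 < n) (a : n.-tuple A) :
  (0 < size (ofo_seq a)) && uniq (ofo_seq a).
Proof.
apply/andP; split; last by rewrite rev_uniq undup_uniq.
case: a => -[|x s] /= sz; last by rewrite ofo_seq_cons.
by rewrite -(eqP sz) in n_gt0.
Qed.

Definition ofo (A : eqType) (n : nat) (n_gt0 : 0 < n) (a : n.-tuple A) :
  Asharp A := exist _ (ofo_seq a) (ofo_subproof n_gt0 a).

Definition weakly_determined_by_ofo (A : eqType) (B : Type) (n : nat)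
  (n_gt0 : 0 < n) (f : n.-tuple A -> B) : Prop :=
  exists (fstar : Asharp A -> B) (sigma : 'S_n),
    forall a : n.-tuple A, f a = fstar (ofo n_gt0 (tuple_map a sigma)).

(* Main.v *)
Require Import Defs.
From mathcomp Require Import all_boot all_order all_fingroup.
From mathcomp Require Import finmap multiset.
From mathcomp Require Import boolp classical_sets.
From mathcomp Require Import zify.

(** Identifying two arguments does not change the order of first occurrence, so
    every identification minor of f is equivalent to F o ofo on A^(n-1), and
    equality of decks means that F (ofo a) = G (ofo (a o w^-1)) for some
    permutation w of n - 1 positions.  The set C_m of permutations w of m
    positions with this property is closed under u v^-1 w, hence a coset of a
    group H_m, and contains every minor of every element of C_(m+1), where a
    minor of a permutation matrix merges two points into the lower left corner
    of their bounding box.  It suffices to show that C_k contains the identity.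
    Quotients of minors of one permutation w yield cycles of consecutive
    positions in H, and from these transpositions and 3-cycles.  Call a column z
    split if w z = z and w preserves the positions below z.  If there is a split
    column z > 0, then H contains all transpositions of positions that no split
    column separates, and the minor deleting z can be sorted.  Otherwise H contains all even
    permutations fixing what the minors have to fix, so that an even minor can be
    sorted; if all minors are odd, w must be 2143... or 13254... and an even
    permutation, which happens only for m = 0, 1 modulo 4.  With two positions
    more than letters this exception is avoided by a suitable first merge. *)

Set Implicit Arguments.
Unset Strict Implicit.
Unset Printing Implicit Defensive.

Local Open Scope group_scope.

(** * Groups containing transpositions and 3-cycles *)
Ltac neq_assumption := by [] || by rewrite eq_sym.
Ltac tperm_fix_in x y z :=
  rewrite (@tpermD _ x y z); [ | neq_assumption | neq_assumption].
Ltac tperm_fix := rewrite tpermD; [ | neq_assumption | neq_assumption].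

Section Linked.

Variables (T : finType) (H : {group {perm T}}).

(* For [t = x] the witness is the transposition of [x] and [y], otherwise it is
   the 3-cycle [x -> y -> t -> x]. *)
Definition linked (x y : T) :=
  x = y \/ exists2 t, t != y & tperm x y * tperm x t \in H.

Lemma linked_tperm x y : tperm x y \in H -> linked x y.
Proof.
have [->|xy] := eqVneq x y; first by left.
by move=> xyH; right; exists x; rewrite ?tperm1 ?mulg1.
Qed.

Lemma linkedJ h x y : h \in H -> linked x y -> linked (h x) (h y).
Proof.
move=> hH [->|[t ty xyH]]; [by left | right; exists (h t)].
  by rewrite (inj_eq perm_inj).
by rewrite -!tpermJ -conjMg groupJ.
Qed.

Lemma linkedVJ h x y : h \in H -> linked (h x) (h y) -> linked x y.
Proof. by move=> hH /(linkedJ (groupVr hH)); rewrite !permK. Qed.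

Lemma linked_sym x y : linked x y -> linked y x.
Proof.
move=> [->|[t ty xyH]]; first by left.
have [->|xy] := eqVneq x y; first by left.
have [tx|tx] := eqVneq t x.
  by apply: linked_tperm; move: xyH; rewrite tx tperm1 mulg1 tpermC.
right; exists t => //; move: xyH.
by rewrite -groupV invMg !tpermV conjgC tpermJ tpermL tpermD 1?eq_sym // (tpermC x y).
Qed.

(** The element linking [x] to [y] fixes [z], so conjugation by it turns the link of [y] and [z]
    into one of [x] and [z]; if [z] is its third point, its inverse is the link. *)
Lemma linked_trans x y z : linked x y -> linked y z -> linked x z.
Proof.
move=> xyL; case: (xyL) => [->//|[t ty xyH]] yz.
have [<-//|yNz] := eqVneq y z.
have [->|xz] := eqVneq x z; first by left.
have [<-//|xy] := eqVneq y x.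
have [zt|zt] := eqVneq t z.
  right; exists y; first by rewrite -zt eq_sym.
  by rewrite -groupV invMg !tpermV -zt.
by apply: (linkedVJ xyH); rewrite !permM tpermL; tperm_fix_in x y z; do 2!tperm_fix.
Qed.

(** The given cycles may use foreign points [s'] and [s]. Conjugating the first by the second
    replaces [y] by [t], and [s'] cancels in the quotient. *)
Lemma linked_cycle x y t : x != y -> y != t -> x != t ->
  linked x y -> linked y t -> tperm x y * tperm x t \in H.
Proof.
move=> xy yt xt [exy|[s' s'y kH]]; first by rewrite exy eqxx in xy.
case=> [eyt|[s st hH]]; first by rewrite eyt eqxx in yt.
have [es|sx] := eqVneq s x.
  by move: hH; rewrite es (tpermC y x) conjgC tpermJ tpermR; tperm_fix.
have hx : (tperm y t * tperm y s) x = x by rewrite permM; tperm_fix_in y t x; tperm_fix.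
have hy : (tperm y t * tperm y s) y = t by rewrite permM tpermL; tperm_fix.
have := groupJ kH hH; rewrite conjMg !tpermJ hx hy.
have [es'|s't] := eqVneq s' t; first by rewrite -es'.
have [es'|s's] := eqVneq s' s.
  rewrite es' in s't s'y *.
  have -> : (tperm y t * tperm y s) s = y.
    by rewrite permM; tperm_fix_in y t s; rewrite tpermR.
  by rewrite -groupV invMg !tpermV.
have -> : (tperm y t * tperm y s) s' = s'.
  by rewrite permM; tperm_fix_in y t s'; tperm_fix.
move=> /groupVr/(groupM kH).
by rewrite invMg !tpermV -mulgA (mulgA (tperm x s')) tperm2 mul1g.
Qed.

(** Conjugating [tperm a b] by the cycle [b -> c -> t -> b] gives [tperm b c] or [tperm a c]; the
    latter is conjugated by [tperm a b]. *)
Lemma linked_tperm_shift a b c : a != b ->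
  tperm a b \in H -> linked b c -> tperm b c \in H.
Proof.
move=> ab abH [->|[t tc hH]]; first by rewrite tperm1 group1.
have [->|bc] := eqVneq b c; first by rewrite tperm1 group1.
have [tb|tb] := eqVneq t b; first by move: hH; rewrite tb tperm1 mulg1.
have [<-|ac] := eqVneq a c; first by rewrite tpermC.
have hb : (tperm b c * tperm b t) b = c by rewrite permM tpermL; tperm_fix.
have := groupJ abH hH; rewrite tpermJ hb.
have [->|a_t] := eqVneq a t; first by rewrite permM; tperm_fix_in b c t; rewrite tpermR.
rewrite permM; tperm_fix_in b c a; tperm_fix_in b t a; move=> acH.
by have := groupJ abH acH; rewrite tpermJ tpermL; tperm_fix; rewrite tpermC.
Qed.

Lemma tperm_mem_trans x y z :
  tperm x y \in H -> tperm y z \in H -> tperm x z \in H.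
Proof.
have [->//|xy] := eqVneq x y; move=> xyH yzH.
have [->|xz] := eqVneq x z; first by rewrite tperm1 group1.
have [<-//|yz] := eqVneq y z.
by have := groupJ xyH yzH; rewrite tpermJ tpermL; tperm_fix.
Qed.

Section Even.

Variables (S : {pred T}) (S_linked : {in S &, forall x y, linked x y}).

Let eq_swap x y t : x \in S -> y \in S -> t \in S -> x != y -> x != t ->
  tperm x y * tperm x t \in H.
Proof.
move=> xS yS tS xy xt; have [<-|yt] := eqVneq y t; first by rewrite tperm2 group1.
by apply: linked_cycle => //; apply: S_linked.
Qed.

Lemma mul_tperm_linked x y z t : x \in S -> y \in S -> z \in S -> t \in S ->
  x != y -> z != t -> tperm x y * tperm z t \in H.
Proof.
move=> xS yS zS tS xy zt.
have [xz|xz] := eqVneq x z; first by rewrite -xz; apply: eq_swap; rewrite // xz.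
have -> : tperm x y * tperm z t = (tperm x y * tperm x z) * (tperm z x * tperm z t).
  by rewrite -mulgA (mulgA (tperm x z)) (tpermC z x) tperm2 mul1g.
by rewrite groupM // eq_swap // eq_sym.
Qed.

Lemma even_perm_linked (g : {perm T}) :
  (forall x, g x != x -> x \in S) -> ~~ odd_perm g -> g \in H.
Proof.
move=> gS /negbTE evg.
(* The induction passes through odd permutations; for these the claim is that multiplying by any
   transposition inside [S] leads into [H]. *)
suff : forall n (h : {perm T}),
    #|[pred x | h x != x]| <= n -> (forall x, h x != x -> x \in S) ->
   if odd_perm h then forall a b, a \in S -> b \in S -> a != b -> h * tperm a b \in H
   else h \in H.
  by move=> /(_ _ g (leqnn _) gS); rewrite evg.
elim=> [|n IHn] h hn hS.
  have -> : h = 1.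
    apply/permP => x; rewrite perm1; apply/eqP/negPn/negP => hx.
    by move: hn; rewrite leqn0 => /eqP/card0_eq/(_ x); rewrite inE hx.
  by rewrite odd_perm1 group1.
have [x hx|h1] := pickP [pred x | h x != x]; last first.
  by apply: IHn => //; rewrite eq_card0.
have xS := hS _ hx; have hxS : h x \in S by apply: hS; rewrite (inj_eq perm_inj).
rewrite /= eq_sym in hx.
pose k := h * tperm x (h x).
have kE y : k y != y -> h y != y.
  apply: contra => /eqP hy; rewrite permM hy; apply/eqP/tpermD.
    by apply: contraNneq hx => ->; rewrite hy.
  apply: contraNneq hx => hxy; have -> : x = y by apply: (@perm_inj _ h); rewrite hy.
  by rewrite hy.
have hk : h = k * tperm x (h x) by rewrite -mulgA tperm2 mulg1.
have {IHn} := IHn k _ (fun y ky => hS y (kE y ky)).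
have -> : odd_perm k = ~~ odd_perm h by rewrite odd_permM odd_tperm hx addbT.
have kn : #|[pred x | k x != x]| <= n.
  rewrite -ltnS; apply: leq_trans hn; apply: proper_card; apply/properP; split.
    by apply/fintype.subsetP => y; rewrite !inE; apply: kE.
  by exists x; rewrite !inE ?permM ?tpermR ?eqxx // eq_sym.
move=> /(_ kn); case: (odd_perm h) => /= [kH a b aS bS ab|].
  by rewrite hk -mulgA groupM // mul_tperm_linked.
by move=> /(_ x (h x) xS hxS hx); rewrite -hk.
Qed.

End Even.

Lemma perm_mem_tperm (g : {perm T}) : (forall x, tperm x (g x) \in H) -> g \in H.
Proof.
have [n] := ubnP #|[pred x | g x != x]|; elim: n g => // n IHn g gn gH.
have [x /= gx|g1] := pickP [pred x | g x != x]; last first.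
  suff -> : g = 1 by rewrite group1.
  by apply/permP => x; have := g1 x; rewrite /= perm1 => /negbFE/eqP.
pose k := g * tperm x (g x).
have -> : g = k * tperm x (g x) by rewrite -mulgA tperm2 mulg1.
have kx : k x = x by rewrite permM tpermR.
have kE y : y != x -> k y = if g y == x then g x else g y.
  move=> yx; rewrite permM; case: eqP => [->|gyx]; first by rewrite tpermL.
  by rewrite tpermD // 1?eq_sym ?(inj_eq perm_inj) //; apply/eqP.
rewrite groupM //; apply: IHn => [|y].
  rewrite ltnS in gn; apply: leq_trans gn; apply: proper_card.
  apply/properP; split; last first.
    by exists x; rewrite !inE // kx eqxx.
  apply/fintype.subsetP => y; rewrite !inE; apply: contra => /eqP gy.
  have yx : y != x by apply: contraNneq gx => <-; rewrite gy.
  by rewrite kE // gy (negbTE yx).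
have [->|yx] := eqVneq y x; first by rewrite kx tperm1 group1.
rewrite kE //; case: eqP => // gyx.
by apply: tperm_mem_trans (gH x); rewrite -gyx.
Qed.

End Linked.

(** * Minors of permutations *)
Section Delete.

Variable N : nat.
Implicit Types (x y a b : 'I_N.+1) (v w : 'S_N.+1) (k : 'I_N).

Definition del_fun y v k : 'I_N := odflt k (unlift (v y) (v (lift y k))).

Lemma lift_del_fun y v k : lift (v y) (del_fun y v k) = v (lift y k).
Proof.
rewrite /del_fun; case: unliftP => [j -> //|/perm_inj/eqP].
by rewrite eq_sym (negbTE (neq_lift _ _)).
Qed.

Lemma del_fun_inj y v : injective (del_fun y v).
Proof.
move=> k1 k2 e; apply: (@lift_inj _ y); apply: (@perm_inj _ v).
by rewrite -!lift_del_fun e.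
Qed.

Definition del y v : 'S_N := perm (@del_fun_inj y v).

Lemma lift_del y v k : lift (v y) (del y v k) = v (lift y k).
Proof. by rewrite permE lift_del_fun. Qed.

Lemma val_del y v k : del y v k = unbump (v y) (v (lift y k)) :> nat.
Proof. by rewrite -lift_del /= bumpK. Qed.

Lemma lift_perm_del y v : lift_perm y (v y) (del y v) = v.
Proof.
apply/permP => i; case: (unliftP y i) => [j ->|->]; last by rewrite lift_perm_id.
by rewrite lift_perm_lift lift_del.
Qed.

Lemma odd_del y v : odd_perm (del y v) = odd_perm v (+) odd y (+) odd (v y).
Proof.
rewrite -{2}(lift_perm_del y v) odd_lift_perm.
by case: (odd y); case: (odd _); case: odd_perm.
Qed.

(** Adjacent rows become indistinguishable once one of them is removed, so either may be deleted
    with column [b]. *)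
Lemma del_adjacent a b w : w a = (w b).+1 :> nat \/ w b = (w a).+1 :> nat ->
  del b (tperm a b * w) = del b w.
Proof.
move=> adj; apply/permP => k; apply/val_inj; rewrite /= !val_del !permM tpermR.
case: tpermP => [->|e|/eqP ca /eqP cb].
- by rewrite /unbump; lia.
- by have := neq_lift b k; rewrite e eqxx.
have: w (lift b k) != w a by rewrite (inj_eq perm_inj).
have: w (lift b k) != w b by rewrite (inj_eq perm_inj).
by rewrite -!(inj_eq val_inj) /= /unbump; lia.
Qed.

(** Both deletions remove the same row, so the row relabellings cancel and the quotient is read off
    from [v1] and [v2]. *)
Lemma del_ratio y1 y2 v1 v2 k : v1 y1 = v2 y2 ->
  v2 (lift y2 ((del y1 v1 * (del y2 v2)^-1) k)) = v1 (lift y1 k).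
Proof. by move=> e; rewrite -lift_del -e permM permKV lift_del. Qed.

(* For [x < y] this replaces the points of the graph of [w] in columns [x] and
   [y] by the lower left corner of their bounding box. *)
Definition minor x y w : 'S_N := del y (if w x < w y then w else tperm x y * w).

End Delete.

Lemma ord_eqVneq n (i j : 'I_n) : i = j \/ i <> j :> nat.
Proof. by have [->|/eqP ij] := eqVneq i j; [left|right => /val_inj]. Qed.

Lemma perm_below n (g : 'S_n) t : (forall i : 'I_n, i < t -> g i < t) ->
  forall i : 'I_n, g i < t -> i < t.
Proof.
move=> gt i; pose A := [set i : 'I_n | i < t].
have sub : g @: A \subset A.
  by apply/fintype.subsetP => _ /imsetP[k kA ->]; move: kA; rewrite !inE => /gt.
have eqA : g @: A = A by apply/eqP; rewrite eqEcard sub (card_imset _ (@perm_inj _ g)) leqnn.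
move=> git; have : g i \in g @: A by rewrite eqA inE.
by rewrite (mem_imset _ _ (@perm_inj _ g)) inE.
Qed.

(** * Links between consecutive positions *)

Section Links.

Variables (N : nat) (H : {group 'S_N}).
Implicit Types (h : 'S_N) (i j t : 'I_N) (p q x y : nat).

Lemma linked_swap h i j : h \in H -> h i = j -> h j = i ->
  (forall k, k != i -> k != j -> h k = k) -> tperm i j \in H.
Proof.
move=> hH hi hj hk; suff <- : h = tperm i j by [].
by apply/permP => k; case: tpermP => [->|->|/eqP ki /eqP kj] //; apply: hk.
Qed.

Lemma linked_cycle3 h i j t : h \in H -> i != j -> j != t -> t != i ->
  h i = j -> h j = t -> h t = i ->
  (forall k, k != i -> k != j -> k != t -> h k = k) -> linked H i j.
Proof.
move=> hH ij jt ti hi hj ht hk; right; exists t; first by rewrite eq_sym.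
suff <- : h = tperm i j * tperm i t by [].
apply/permP => k; rewrite permM.
case: (tpermP i j k) => [->|->|/eqP ki /eqP kj].
- by rewrite hi; tperm_fix.
- by rewrite tpermL.
have [->|kt] := eqVneq k t; first by rewrite tpermR.
by rewrite hk //; tperm_fix.
Qed.

(** Natural numbers allow arithmetic on positions. The property is vacuous outside the range, hence
    the bound on the middle position in [nlinked_trans]. *)
Definition nlinked p q := forall i j, i = p :> nat -> j = q :> nat -> linked H i j.

Lemma nlinked_refl p : nlinked p p.
Proof. by move=> i j ei ej; left; apply: val_inj; rewrite /= ei ej. Qed.

Lemma nlinked_sym p q : nlinked p q -> nlinked q p.
Proof. by move=> pq i j ei ej; apply/linked_sym/pq. Qed.

Lemma nlinked_trans q p r : q < N -> nlinked p q -> nlinked q r -> nlinked p r.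
Proof.
move=> qN pq qr i j ei ej.
by apply: (@linked_trans _ _ _ (Ordinal qN)); [apply: pq|apply: qr].
Qed.

Lemma nlinked_range l u : u < N -> (forall p, l <= p -> p < u -> nlinked p p.+1) ->
  forall p q, l <= p -> p <= u -> l <= q -> q <= u -> nlinked p q.
Proof.
move=> uN step p q lp pu lq qu.
suff from_l r : l <= r -> r <= u -> nlinked l r.
  by apply: (@nlinked_trans l); [lia|apply/nlinked_sym/from_l|apply: from_l].
elim: r => [|r IHr] lr ru.
  have -> : l = 0 by lia.
  exact: nlinked_refl.
have [->|lr'] : l = r.+1 \/ l <= r by lia.
  exact: nlinked_refl.
by apply: (@nlinked_trans r); [lia|apply: IHr; lia|apply: step; lia].
Qed.

Definition down_cycle x y h := forall k : 'I_N,
  [/\ k = x :> nat -> h k = y.-1 :> nat, x < k < y -> h k = k.-1 :> nat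
    & k < x \/ y <= k -> h k = k :> nat].

(** Conjugation by [h] shifts links along the cycle, so one link yields all. Cycles of length 2 or 3
    are links themselves; longer ones need one from outside. *)
Lemma down_cycle_linked x y h : x.+2 <= y -> y <= N -> h \in H ->
  down_cycle x y h ->
  (x.+4 <= y -> exists g, [/\ x <= g, g.+1 < y & nlinked g g.+1]) ->
  forall p, x <= p -> p.+1 < y -> nlinked p p.+1.
Proof.
move=> xy yN hH hE long.
have shift p : x < p -> p.+1 < y -> nlinked p p.+1 <-> nlinked p.-1 p.
  move=> xp py; have lp : p < N by lia. have lp1 : p.+1 < N by lia.
  have lp2 : p.-1 < N by lia.
  split=> L i j ei ej.
    have := linkedJ hH (L (Ordinal lp) (Ordinal lp1) erefl erefl).
    by congr linked; apply: val_inj; rewrite /= ?ei ?ej; have [] := hE (Ordinal lp);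
      have [] := hE (Ordinal lp1); rewrite /=; lia.
  apply: (linkedVJ hH); apply: L; have [] := hE i; have [] := hE j; lia.
have [d4|d4] := leqP x.+4 y.
  have [g [xg gy Lg]] := long d4.
  have Lx : nlinked x x.+1.
    elim: g xg gy Lg => [|g IH] xg gy Lg; first by have -> : x = 0 by lia.
    have [->//|{}xg] : x = g.+1 \/ x < g.+1 by lia.
    by apply: IH; [lia|lia|]; apply/(shift g.+1).
  elim=> [|p IH] xp py; first by have -> : 0 = x by lia.
  have [<-//|{}xp] : x = p.+1 \/ x < p.+1 by lia.
  by apply/(shift p.+1); [lia|lia|]; apply: IH; lia.
move=> p xp py i j ei ej.
have [ey|ey] : y = x.+2 \/ y = x.+3 by lia.
  by apply: linked_tperm; apply: (linked_swap hH) => [||k];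
    rewrite -?val_eqE /= => *; apply: val_inj; 
    [have [] := hE i|have [] := hE j|have [] := hE k]; rewrite /=; lia.
have lt : x.+1 < N by lia. have l0 : x < N by lia. have l2 : x.+2 < N by lia.
have hk (k t : 'I_N) : (k = x :> nat -> t = x.+2 :> nat) ->
    (k = x.+1 :> nat -> t = x :> nat) -> (k = x.+2 :> nat -> t = x.+1 :> nat) ->
    (k < x \/ x.+2 < k -> t = k :> nat) -> h k = t.
  by move=> ? ? ? ?; apply: val_inj; have [] := hE k; rewrite /=; lia.
have [ep|ep] : p = x \/ p = x.+1 by lia.
  apply: linked_sym; apply: (@linked_cycle3 h j i (Ordinal l2)) => // [||||||k];
    rewrite -?val_eqE /= => *; do ?[apply: hk]; rewrite ?ei ?ej /=; lia.
apply: linked_sym; apply: (@linked_cycle3 h j i (Ordinal l0)) => // [||||||k];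
    rewrite -?val_eqE /= => *; do ?[apply: hk]; rewrite ?ei ?ej /=; lia.
Qed.

End Links.

(** * The coset of the minors of one permutation *)
Section Core.

Variables (N : nat) (w : 'S_N.+1) (H : {group 'S_N}) (c : 'S_N).
Hypothesis minor_mem : forall x y : 'I_N.+1, x < y -> minor x y w \in H :* c.

Implicit Types (x y z a b s : 'I_N.+1) (v : 'S_N.+1) (k i j : 'I_N) (p q t : nat).

Lemma coset_div (g1 g2 : 'S_N) : g1 \in H :* c -> g2 \in H :* c -> g1 * g2^-1 \in H.
Proof.
rewrite !mem_rcoset => g1H g2H.
by have := groupM g1H (groupVr g2H); rewrite invMg invgK mulgA mulgKV.
Qed.

(* A column that can be deleted by merging it with a point to its lower left. *)
Definition anchored x := [exists s : 'I_N.+1, (s < x) && (w s < w x)].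

Lemma anchoredI s x : s < x -> w s < w x -> anchored x.
Proof. by move=> sx wsx; apply/existsP; exists s; rewrite sx. Qed.

Lemma del_mem x : anchored x -> del x w \in H :* c.
Proof. by case/existsP=> s /andP[sx wsx]; have := minor_mem sx; rewrite /minor wsx. Qed.

Lemma del_swap_mem x y : x < y -> w y < w x -> del y (tperm x y * w) \in H :* c.
Proof. by move=> xy wyx; have := minor_mem xy; rewrite /minor ltnNge ltnW. Qed.

Lemma del_swap_adjacent_mem a b : anchored b ->
  w a = (w b).+1 :> nat \/ w b = (w a).+1 :> nat ->
  del b (tperm a b * w) \in H :* c.
Proof. by move=> bA ab; rewrite del_adjacent //; apply: del_mem. Qed.

Lemma down_cycle_mem x y : x < y ->
  del x w \in H :* c -> del y (tperm x y * w) \in H :* c ->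
  exists2 h, h \in H & down_cycle x y h.
Proof.
move=> xy xC yC; exists (del y (tperm x y * w) * (del x w)^-1); first exact: coset_div.
move=> k; have := @del_ratio _ y x (tperm x y * w) w k.
rewrite !permM tpermR => /(_ erefl)/perm_inj/(congr1 val) /=.
move: ((del x w)^-1 _) => h.
case: tpermP => [/(congr1 val)|/(congr1 val)|_ _] /=; rewrite /bump; split; lia.
Qed.

(** The cycle [a -> y -> y.+1 -> ... -> y'.-1 -> a], the quotient of two deletions of row [w a]. *)
Definition up_cycle a y y' (h : 'S_N) := forall k,
  [/\ k = a :> nat -> h k = y :> nat, k = y'.-1 :> nat -> h k = a :> nat,
      y <= k < y'.-1 -> h k = k.+1 :> nat
    & k <> a :> nat -> k < y \/ y' <= k -> h k = k :> nat].

Lemma up_cycle_mem a y y' : a < y -> y < y' ->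
  del y (tperm a y * w) \in H :* c -> del y' (tperm a y' * w) \in H :* c ->
  exists2 h, h \in H & up_cycle a y y' h.
Proof.
move=> ay yy' yC y'C.
exists (del y (tperm a y * w) * (del y' (tperm a y' * w))^-1); first exact: coset_div.
move=> k; have := @del_ratio _ y y' (tperm a y * w) (tperm a y' * w) k.
rewrite !permM !tpermR => /(_ erefl)/perm_inj; move: ((del y' _)^-1 _) => h.
move/(canRL (tpermK _ _))/(congr1 val) => /=.
case: (tpermP a y) => [/(congr1 val)|/(congr1 val)|/eqP];
  case: tpermP => [/(congr1 val)|/(congr1 val)|/eqP];
  rewrite -?val_eqE /= /bump; split; lia.
Qed.

(** Deleting [x] and merging [x] with [y] differ by a cycle; if it is long, a shorter inversion
    provides the link that it needs. *)
Lemma inversion_linked x y : anchored x -> w y < w x -> x.+2 <= y ->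
  forall p, x <= p -> p.+1 < y -> nlinked H p p.+1.
Proof.
have [n] := ubnP (y - x); elim: n x y => // n IHn x y yxn xA wyx xy.
have yN : y <= N by rewrite -ltnS.
have [h hH hE] := down_cycle_mem (ltnW xy) (del_mem xA) (del_swap_mem (ltnW xy) wyx).
apply: (down_cycle_linked xy yN hH hE) => xy4.
(* Either [x] and [z] form an inversion, or [x] anchors [z], which forms one with [y]. At distance 2
   from [x], both are long enough for the induction. *)
have zN : x.+2 < N.+1 by lia.
pose z := Ordinal zN.
have [wzx|wxz|/val_inj/perm_inj exz] := ltngtP (w z) (w x).
- by exists x; split; [by []|lia|]; apply: (IHn x z) => //=; lia.
- have zA : anchored z by apply: (anchoredI (s := x)).
  exists z; split; [by rewrite /=; lia|by rewrite /=; lia|].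
  by apply: (IHn z y) => //=; lia.
- by have := congr1 val exz; rewrite /=; lia.
Qed.

Definition cut t := [forall x : 'I_N.+1, (x < t) ==> (w x < t)].

Lemma cutP t : reflect (forall x : 'I_N.+1, x < t -> w x < t) (cut t).
Proof. exact/'forall_implyP. Qed.

Lemma cut_col t x : cut t -> w x < t -> x < t.
Proof. by move=> /cutP ct; apply: perm_below. Qed.

Lemma not_cut t : ~~ cut t ->
  (exists2 x : 'I_N.+1, x < t & t <= w x) /\ (exists2 y : 'I_N.+1, t <= y & w y < t).
Proof.
move=> nct; split.
  by case/forallPn: nct => x; rewrite negb_imply -leqNgt => /andP[xt wxt]; exists x.
have [|no] := boolP [exists y : 'I_N.+1, (t <= y) && (w y < t)].
  by case/existsP => y /andP[ty wyt]; exists y.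
case/negP: nct; apply/cutP => x xt.
have : w^-1 (w x) < t by rewrite permK.
apply: perm_below => i it; rewrite ltnNge; apply: contra no => ti.
by apply/existsP; exists (w^-1 i); rewrite ti permKV.
Qed.

(** Since rows [t.-1] and [t] are adjacent, [a] and [b] produce the cycle of an inversion although
    they are in order. *)
Lemma cut_linked t a b : cut t -> w a = t.-1 :> nat -> w b = t :> nat -> 0 < t ->
  anchored a -> forall p, a <= p -> p.+1 < b -> nlinked H p p.+1.
Proof.
move=> ct wa wb t0 aA p ap pb.
have lta : a < t by apply: (cut_col ct); lia.
have leb : t <= b by rewrite leqNgt; apply/negP => /(cutP _ ct); lia.
have bN : b <= N by rewrite -ltnS.
have ab : a < b by lia. have ab2 : a.+2 <= b by lia.
have [|h hH hE] := down_cycle_mem ab (del_mem aA).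
  by apply: del_swap_adjacent_mem; [apply: (anchoredI ab)|]; lia.
apply: (down_cycle_linked ab2 bN hH hE) ap pb => ab4.
(* Column [t.-1] has a value below [w a] and forms an inversion with [a]. If it is too close to [a],
   column [t] has a value above [w b] and forms one with [b]. *)
have [at2|at2] := leqP a.+2 t.-1.
  exists a; split; [by []|lia|].
  have uN : t.-1 < N.+1 by lia.
  have := cutP _ ct (Ordinal uN); have : w (Ordinal uN) <> w a.
    by move/perm_inj/(congr1 val) => /=; lia.
  move/eqP; rewrite -val_eqE /= => wu /(_ ltac:(lia)) wut.
  by apply: (inversion_linked (y := Ordinal uN) aA) => /=; lia.
exists t; split; [lia|lia|].
have uN : t < N.+1 by lia.
have wu : t < w (Ordinal uN).
  have : ~~ (w (Ordinal uN) < t) by apply/negP => /(cut_col ct) /=; lia.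
  have : w (Ordinal uN) <> w b by move/perm_inj/(congr1 val) => /=; lia.
  by move/eqP; rewrite -val_eqE /=; lia.
apply: (@inversion_linked (Ordinal uN) b) => //=; try lia.
have w0 := cutP _ ct ord0 t0.
by apply: (anchoredI (s := ord0)) => //=; lia.
Qed.

(** * Merges with the first column when it is not fixed *)

Section Low.

Hypothesis w0_gt0 : 0 < w ord0.

(* The columns whose merge with column [0] amounts to deleting the row of
   column [0]; for the next higher row this is [del_adjacent]. *)
Definition low y := (0 < y) && (w y <= (w ord0).+1).

Lemma w0_neq y : 0 < y -> w y <> w ord0 :> nat.
Proof. by move=> y0 /val_inj/perm_inj ey; rewrite ey in y0. Qed.

Lemma low_mem y : low y -> del y (tperm ord0 y * w) \in H :* c.
Proof.
case/andP => y0 wy; have [wy0|wy0|/w0_neq//] := ltngtP (w y) (w ord0).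
  exact: del_swap_mem.
by apply: del_swap_adjacent_mem; [apply: (anchoredI (s := ord0))|lia].
Qed.

Lemma high_anchored y : 0 < y -> ~~ low y -> anchored y.
Proof. by move=> y0; rewrite /low y0 /= => wy; apply: (anchoredI (s := ord0)) => //; lia. Qed.

(** The merges of column [0] with [y] and [y'] differ by an up cycle. If it is long, the high column
    [y.+1] forms an inversion with [y'], and conjugation carries its links back to [y] and [0]. *)
Lemma low_next_linked y y' : low y -> low y' -> y < y' ->
  (forall z, y < z -> z < y' -> ~~ low z) ->
  forall p, y <= p -> p < y' -> nlinked H 0 p.
Proof.
move=> yL y'L yy' high.
have y0 : 0 < y by case/andP: yL.
have y'N : y' <= N by rewrite -ltnS.
have [h hH hE] := @up_cycle_mem ord0 y y' y0 yy' (low_mem yL) (low_mem y'L).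
have ly : y < N by lia.
have hk (k t : 'I_N) : (k = 0 :> nat -> t = y :> nat) ->
    (k = y'.-1 :> nat -> t = 0 :> nat) -> (y <= k < y'.-1 -> t = k.+1 :> nat) ->
    (k <> 0 :> nat -> k < y \/ y' <= k -> t = k :> nat) -> h k = t.
  by move=> ? ? ? ?; apply: val_inj; have [] := hE k; rewrite /=; lia.
have [ey|[ey|ey]] : y' = y.+1 :> nat \/ y' = y.+2 :> nat \/ y.+3 <= y' by lia.
- move=> p yp py i j ei ej.
  apply: linked_tperm; apply: (linked_swap hH) => [||k];
    rewrite -?val_eqE /= => *; apply: hk; lia.
- have ly1 : y.+1 < N by lia.
  move=> p yp py i j ei ej; have [ep|ep] : p = y \/ p = y.+1 by lia.
    apply: (@linked_cycle3 _ _ h i j (Ordinal ly1)) => // [|||||| k];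
      rewrite -?val_eqE /= => *; do ?[apply: hk]; rewrite ?ei ?ej /=; lia.
  apply: linked_sym; apply: (@linked_cycle3 _ _ h j i (Ordinal ly)) => // [|||||| k];
      rewrite -?val_eqE /= => *; do ?[apply: hk]; rewrite ?ei ?ej /=; lia.
have y1N : y.+1 < N.+1 by lia.
pose y1 := Ordinal y1N.
have y1H : ~~ low y1 by apply: high => /=; lia.
have step : forall p, y.+1 <= p -> p.+1 < y' -> nlinked H p p.+1.
  apply: (@inversion_linked y1 y') => //; first exact: high_anchored.
  by move: y1H y'L; rewrite /low /=; lia.
have ly1 : y.+1 < N by lia.
have ly2 : y.+2 < N by lia.
have L1 : nlinked H y y.+1.
  move=> i j ei ej; apply: (linkedVJ hH).
  rewrite (hk i (Ordinal ly1)) ?(hk j (Ordinal ly2)) /=; try lia.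
  by apply: (step y.+1) => /=; lia.
have L0 : nlinked H 0 y.
  move=> i j ei ej; apply: (linkedVJ hH).
  rewrite (hk i (Ordinal ly)) ?(hk j (Ordinal ly1)) /=; try lia.
  by apply: L1 => /=; lia.
move=> p yp py; apply: (nlinked_trans ly L0).
apply: (@nlinked_range _ _ y y'.-1) => [|q yq qy|||| ]; try lia.
have [eq|yq'] : q = y \/ y.+1 <= q by lia.
  by rewrite eq.
by apply: step; lia.
Qed.

Lemma low_linked z y : low z -> low y -> forall p, z <= p -> p < y -> nlinked H 0 p.
Proof.
move=> zL yL p zp py.
have [m /andP[mp mL] mM] := @arg_maxnP _ z [pred i : 'I_N.+1 | (i <= p) && low i] val
  (introT andP (conj zp zL)).
have [n /andP[np nL] nM] := @arg_minnP _ y [pred i : 'I_N.+1 | (p < i) && low i] val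
  (introT andP (conj py yL)).
apply: (low_next_linked mL nL) => // [|i mi ni]; first exact: leq_ltn_trans np.
apply/negP => iL; have [ip|pi] := leqP i p.
  by have := mM i; rewrite /= ip iL => /(_ isT); lia.
by have := nM i; rewrite /= pi iL => /(_ isT); lia.
Qed.

Lemma low_all_linked z y : low z -> low y -> z < y ->
  forall p, p < y -> nlinked H 0 p.
Proof.
move=> zL yL zy p py.
have [->|p0] := posnP p; first exact: nlinked_refl.
have yN : y <= N by rewrite -ltnS.
have [zp|pz] := leqP z p; first exact: (low_linked zL yL).

have pN : p < N.+1 by lia.
(* If the first low column [n] from [p] on is not [p], then column [p] is high and its inversion
   with [y] links [p] to [n]. *)
have [n /andP[np nL] nM] := @arg_minnP _ z [pred i : 'I_N.+1 | (p <= i) && low i] val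
  (introT andP (conj (ltnW pz) zL)).
have nz := nM z; rewrite /= zL (ltnW pz) in nz; have {}nz := nz isT.
have [en|pn] : n = p :> nat \/ p < n by lia.
  by apply: (low_linked nL yL); lia.
have pH : ~~ low (Ordinal pN).
  by apply/negP => pL; have := nM (Ordinal pN); rewrite /= leqnn pL => /(_ isT); lia.
have step : forall q, p <= q -> q.+1 < y -> nlinked H q q.+1.
  apply: (@inversion_linked (Ordinal pN) y) => //=; last lia.
    exact: high_anchored.
  by move: pH yL; rewrite /low /= p0 /=; lia.
apply: (@nlinked_trans _ _ n); [lia|by apply: (low_linked nL yL); lia|].
apply: (@nlinked_range _ _ p y.-1); try lia.
by move=> q pq qy; apply: step; lia.
Qed.

Lemma low_max : 1 < N ->
  exists2 y, low y & (forall z, low z -> z <= y) /\ (exists2 z, low z & z < y).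
Proof.
(* Rows [0] and [1] belong to low columns; row [2] replaces row [1] if the latter is the row of
   column [0]. *)
move=> N1; have rN : (if w ord0 == 1%N :> nat then 2 else 1%N) < N.+1 by case: ifP => _; lia.
pose y0 := w^-1 ord0; pose y1 := w^-1 (Ordinal rN).
have nz y : w y <> w ord0 :> nat -> 0 < y.
  by rewrite lt0n; case: eqP => // /(@val_inj _ _ _ y ord0) ->.
have L0 : low y0.
  by apply/andP; split; [apply: nz|]; rewrite permKV /=; lia.
have L1 : low y1.
  apply/andP; split; [apply: nz|]; rewrite permKV /=; case: ifP; lia.
have y01 : y0 <> y1 by move/(congr1 w)/(congr1 val); rewrite !permKV /=; case: ifP.
have [y yL yM] := @arg_maxnP _ y0 low val L0.
exists y => //; split=> [z zL|]; first exact: yM.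
have [e0|n0] := eqVneq y0 y.
  exists y1 => //; rewrite ltn_neqAle; apply/andP; split; last exact: yM.
  by rewrite val_eqE -e0 eq_sym; apply/eqP.
by exists y0 => //; rewrite ltn_neqAle val_eqE n0; apply: yM.
Qed.

End Low.

(** * Links across columns that are not split *)

Definition split z := cut z && (w z == z :> nat).

Lemma cut_fixed z : w z = z :> nat -> cut z.+1 = cut z.
Proof.
move=> wz; apply/cutP/cutP => cz x xz.
  have : w x <> w z by move/perm_inj/(congr1 val) => /=; lia.
  by move/eqP; rewrite -val_eqE /=; have := cz x (ltnW xz); lia.
have [->|xz'] : x = z \/ x < z; last by have := cz x xz'; lia.
  by have [->|ne] := ord_eqVneq x z; [left|right; lia].
by rewrite wz.
Qed.

(** Without inversions across [z], the cut at [z] fails only if column [z] goes down, and the cut at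
    [z.+1] only if it goes up. *)
Lemma uncrossed_cut z : (forall x y, x < z -> z < y -> ~~ (w y < w x)) ->
  cut z \/ cut z.+1.
Proof.
move=> unc; have [|/not_cut[[x xz zx] [y zy yz]]] := boolP (cut z); first by left.
have [|/not_cut[[x' xz' zx'] [y' zy' yz']]] := boolP (cut z.+1); first by right.
have [ey|zy1] : y = z \/ z < y.
  by have [->|ne] := ord_eqVneq y z; [left|right; lia].
  have [ex|xz1] : x' = z \/ x' < z.
    by have [->|ne] := ord_eqVneq x' z; [left|right; lia].
    by rewrite ex in zx'; rewrite ey in yz; lia.
  by have := unc _ _ xz1 zy'; lia.
by have := unc _ _ xz zy1; lia.
Qed.

(** The link comes from an anchored inversion across [z], from low columns beyond [z], or from a cut
    at [z] or [z.+1]. The last hypothesis is there because all minors fix position [0] if [w]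
    does. *)
Lemma gap_linked z : 0 < z -> z < N -> ~~ split z -> (w ord0 = ord0 -> z <> 1%N :> nat) ->
  nlinked H z.-1 z.
Proof.
move=> z0 zN nsplit z1.
have [/existsP[x /existsP[y /and4P[xz zy wyx xA]]]|/existsPn nocross] :=
    boolP [exists x : 'I_N.+1, exists y : 'I_N.+1,
             [&& x < z, z < y, w y < w x & anchored x]].
  have -> : nlinked H z.-1 z = nlinked H z.-1 z.-1.+1 by rewrite prednK.
  by apply: (inversion_linked xA wyx); lia.
have unc x y : x < z -> z < y -> anchored x -> ~~ (w y < w x).
  move=> xz zy xA; have /existsPn/(_ y) := nocross x.
  by rewrite xz zy xA andbT.
have [/andP[w0_gt0 /existsP[u /andP[uL zu]]]|nolow] :=
    boolP ((0 < w ord0) && [exists u, low u && (z < u)]).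
  have [y yL [yM [y' y'L yy']]] := low_max w0_gt0 (leq_ltn_trans z0 zN).
  have zy := leq_trans zu (yM u uL).
  apply: (@nlinked_trans _ _ 0); [lia|apply: nlinked_sym|];
  by apply: (low_all_linked w0_gt0 y'L yL yy'); lia.
(* By [anch] no inversion crosses [z], so there is a cut [t], and the columns of rows [t.-1] and [t]
   lie on both sides of [z]. By [corner] the first of them is not column [0], so it is anchored. *)
suff [anch corner] : (forall x y, x < z -> z < y -> w y < w x -> anchored x) /\
    (forall t b, t.-1 <= z -> z <= t -> w ord0 = t.-1 :> nat -> w b = t :> nat ->
       0 < t -> ~~ (z < b)).
  have [t [ct tz zt]] : exists t, [/\ cut t, t.-1 <= z & z <= t].
    have [|ct|ct] := @uncrossed_cut z; [|by exists z; split => //; lia|by exists z.+1].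
    by move=> x y xz zy; apply/negP => wyx; move: (wyx); apply/negP/unc => //; apply: anch wyx.
  have t1N : t.-1 < N.+1 by lia.
  have tN : t < N.+1 by lia.
  have t0 : 0 < t by lia.
  have [a wa] : exists a, w a = t.-1 :> nat.
    by exists (w^-1 (Ordinal t1N)); rewrite permKV.
  have [b wb] : exists b, w b = t :> nat by exists (w^-1 (Ordinal tN)); rewrite permKV.
  have wz : w z <> z :> nat.
    move=> wz; move: nsplit; rewrite /split wz eqxx andbT.
    have [<-|et] : t = z \/ t = z.+1 by lia.
      by rewrite ct.
    by rewrite -(cut_fixed wz) -et ct.
  have lta : a < t by apply: (cut_col ct); lia.
  have leb : t <= b by rewrite leqNgt; apply/negP => /(cutP _ ct); lia.
  have za : a < z by have [ea|] := ord_eqVneq a z; [rewrite ea in wa lta *|]; lia.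
  have zb : z < b by have [eb|] := ord_eqVneq b z; [rewrite eb in wb leb *|]; lia.
  have aA : anchored a.
    have [ea|a0] := ord_eqVneq a ord0.
      by have := corner t b tz zt; rewrite -ea => /(_ wa wb t0); rewrite zb.
    have := cutP _ ct ord0 t0.
    have : w ord0 <> w a by move=> /perm_inj ea; apply: a0; rewrite -ea.
    move/eqP; rewrite -val_eqE /= => ne w0t.
    by apply: (anchoredI (s := ord0)); rewrite ?lt0n; [apply/eqP|lia].
  have -> : nlinked H z.-1 z = nlinked H z.-1 z.-1.+1 by rewrite prednK.
  by apply: (cut_linked ct wa wb t0 aA); lia.
have [w00|w0_gt0] := posnP (w ord0).
  split=> [x y xz zy wyx|t b tz zt w0t wb t0].
    apply: (anchoredI (s := ord0)); last by lia.
    by rewrite lt0n; apply/eqP => /(@val_inj _ _ _ x ord0) ex; move: wyx; rewrite ex w00.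
  by have := z1 (@val_inj _ _ _ (w ord0) ord0 w00); lia.
have yM u : low u -> u <= z.
  move=> uL; rewrite leqNgt; apply: contra nolow => zu.
  by rewrite w0_gt0; apply/existsP; exists u; rewrite uL.
split=> [x x' xz zx' wx'|t b tz zt w0t wb t0].
  have x'H : ~~ low x' by apply/negP => /yM; lia.
  rewrite /low in x'H.
  apply: (anchoredI (s := ord0)); last by lia.
  by rewrite lt0n; apply/eqP => /(@val_inj _ _ _ x ord0) ex; move: wx' x'H; rewrite ex; lia.
apply/negP => zb; have bL : low b by apply/andP; split; lia.
by have := yM b bL; lia.
Qed.

Lemma one_mem (g : 'S_N) : g \in H :* c -> g \in H -> 1 \in H :* c.
Proof. by rewrite !mem_rcoset mul1g => gcH gH; have := groupM (groupVr gH) gcH; rewrite mulKg. Qed.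

Lemma unsplit_even_minor x y : (forall z, 0 < z -> ~~ split z) ->
  x < y -> ~~ odd_perm (minor x y w) -> 1 \in H :* c.
Proof.
move=> nosplit xy even; apply: (one_mem (minor_mem xy)).
(* Position [0] is left out exactly when [w] fixes it; the minor then fixes it too. *)
pose S := [pred i : 'I_N | (w ord0 != ord0) || (0 < i)].
apply: (@even_perm_linked _ _ S) even => [i j iS jS|k].
  pose l : nat := w ord0 == ord0.
  have lS (k : 'I_N) : k \in S -> l <= k by rewrite inE /l; case: eqP => //=.
  have iN : i < N by []. have jN : j < N by [].
  apply: (@nlinked_range _ H l N.-1) (erefl _) (erefl _) => [|p lp pN||||]; try lia.
  - have zN : p.+1 < N.+1 by lia.
    apply: (@gap_linked (Ordinal zN)) => //= [||w0 [p0]]; [lia|exact: nosplit|].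
    by move: lp; rewrite /l w0 eqxx p0.
  - exact: lS.
  - exact: lS.
apply: contraR; rewrite inE negb_or negbK -leqNgt leqn0 => /andP[/eqP w0 /eqP k0].
apply/eqP; apply: val_inj; rewrite /= val_del k0.
have lk : lift y k = ord0 by apply: val_inj; rewrite /= k0 /bump; lia.
case: ifP => wxy; rewrite ?permM lk ?(@tpermD _ x y ord0) ?w0 //=.
- apply: contraFneq wxy => ->; rewrite w0 lt0n; apply/negP => /eqP.
  by move/(@val_inj _ _ _ (w y) ord0); rewrite -{1}w0 => /perm_inj ey; rewrite ey in xy.
- by rewrite -val_eqE /=; lia.
Qed.

(** * Transpositions next to split columns *)

Lemma class_tperm (a b i j : 'I_N) : a != b -> tperm a b \in H ->
  linked H b i -> linked H b j -> tperm i j \in H.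
Proof.
move=> ab abH bi bj; apply: (@tperm_mem_trans _ _ _ b).
  by rewrite tpermC; apply: (linked_tperm_shift ab).
exact: (linked_tperm_shift ab).
Qed.

Lemma cut_anchored z t : cut t -> 0 < t -> t <= z -> t <= w z -> anchored z.
Proof.
move=> ct t0 tz twz; have w0 := cutP _ ct ord0 t0.
by apply: (anchoredI (s := ord0)) => /=; lia.
Qed.

(* Merging the last column of the block with the column holding its top value,
   and deleting [z] instead, differ by a transposition. *)
Lemma tperm_before_split z q (i j : 'I_N) : split z -> 0 < q -> q < z ->
  (forall r : 'I_N.+1, q <= r -> r < z -> ~~ split r) -> (w ord0 = ord0 -> q <> 1%N) ->
  i = q.-1 :> nat -> j = q :> nat -> tperm i j \in H.
Proof.
move=> /andP[cz /eqP wz] q0 qz ns q1 ei ej.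
have zN : z <= N by rewrite -ltnS.
have pN : z.-1 < N.+1 by lia.
pose p := Ordinal pN.
have pz : z = p.+1 :> nat by rewrite /=; lia.
have wp : w p <> p :> nat.
  move=> wp; have := ns p; rewrite /split wp eqxx andbT -(cut_fixed wp) -pz cz.
  by move=> /(_ ltac:(rewrite /=; lia) ltac:(rewrite /=; lia)).
have wpz := cutP _ cz p ltac:(rewrite /=; lia).
pose a := w^-1 p; have wa : w a = p by rewrite permKV.
have az : a < z by apply: (cut_col cz); rewrite wa /=; lia.
have ap : a < p.
  have [eap|] := ord_eqVneq a p; last by rewrite /=; lia.
  by case: wp; rewrite -{1}eap wa.
have pltz : p < z by rewrite /=; lia.
have [||h hH hE] := up_cycle_mem ap pltz.
- by apply: del_swap_mem => //; rewrite wa; lia.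
- apply: del_swap_adjacent_mem; last by rewrite wa wz; lia.
  by apply: (cut_anchored cz); lia.
have aN : a < N by lia.
have pN' : p < N by lia.
have abH : tperm (Ordinal aN) (Ordinal pN') \in H.
  apply: (linked_swap hH) => [||k]; rewrite -?val_eqE /= => *; apply: val_inj => /=.
  - by have [] := hE (Ordinal aN); rewrite /=; lia.
  - by have [] := hE (Ordinal pN'); rewrite /=; lia.
  - by have [] := hE k; rewrite /=; lia.
have range : forall r s : nat, q.-1 <= r -> r <= p -> q.-1 <= s -> s <= p -> nlinked H r s.
  apply: nlinked_range => // r qr rp.
  have rN : r.+1 < N.+1 by lia.
  apply: (@gap_linked (Ordinal rN)) => //=; [lia|apply: ns|move=> /q1]; rewrite /=; lia.
apply: (@class_tperm (Ordinal aN) (Ordinal pN')) => //.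
- by rewrite -val_eqE /=; lia.
- by apply: (range p q.-1) => //=; lia.
- by apply: (range p q) => //=; lia.
Qed.

(** Down cycles from [z] and from [z.+1] to the same column [a] differ by the transposition of [z]
    and [z.+1], which turns the links from [z] to [q] into transpositions. *)
Lemma tperm_after_split z q (i j : 'I_N) : split z -> 0 < z -> z < q -> q < N ->
  (forall r : 'I_N.+1, z < r -> r <= q -> ~~ split r) ->
  i = q.-1 :> nat -> j = q :> nat -> tperm i j \in H.
Proof.
move=> /andP[cz /eqP wz] z0 zq qN ns ei ej.
have pN : z.+1 < N.+1 by lia.
pose p := Ordinal pN.
have cp : cut p by rewrite /= (cut_fixed wz).
have wp : w p <> p :> nat.
  by move=> wp; have := ns p; rewrite /split wp eqxx cp => /(_ ltac:(by []) ltac:(by [])).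
have wpp : ~~ (w p < p) by apply/negP => /(cut_col cp); lia.
pose a := w^-1 p; have wa : w a = p by rewrite permKV.
have pa : p < a.
  have [eap|] := ord_eqVneq a p; first by case: wp; rewrite -{1}eap wa.
  by have := cutP _ cp a; rewrite wa /=; lia.
have za : z < a by move: pa => /=; lia.
have pa' : z.+1 < a by [].
have aN : a <= N by rewrite -ltnS.
have zA : anchored z by apply: (cut_anchored cz); rewrite ?wz.
have [|h1 h1H h1E] := down_cycle_mem za (del_mem zA).
  apply: del_swap_adjacent_mem; last by rewrite wa wz; right.
  by apply: (anchoredI za); rewrite wa wz /=.
have [||h2 h2H h2E] := down_cycle_mem pa.
- by apply: del_mem; apply: (cut_anchored cp) => //; rewrite leqNgt.
- by apply: del_swap_mem; rewrite // wa; lia.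
have zN : z < N by lia.
have pN' : p < N by rewrite /=; lia.
have hH := groupM h1H (groupVr h2H).
have hk (k l : 'I_N) : h1 k = h2 l :> nat -> (h1 * h2^-1) k = l.
  by move=> /val_inj e; rewrite permM e permK.
have abH : tperm (Ordinal pN') (Ordinal zN) \in H.
  rewrite tpermC; apply: (linked_swap hH) => [||k]; rewrite -?val_eqE /= => *; apply: hk.
  - by have [] := h1E (Ordinal zN); have [] := h2E (Ordinal pN'); rewrite /=; lia.
  - by have [] := h1E (Ordinal pN'); have [] := h2E (Ordinal zN); rewrite /=; lia.
  - by have [] := h1E k; have [] := h2E k; rewrite /=; lia.
have range : forall r s : nat, z <= r -> r <= q -> z <= s -> s <= q -> nlinked H r s.
  apply: nlinked_range => // r zr rq.
  have rN : r.+1 < N.+1 by lia.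
  apply: (@gap_linked (Ordinal rN)) => //=; [lia|apply: ns|]; rewrite /=; lia.
apply: (@class_tperm (Ordinal pN') (Ordinal zN)) => //.
- by rewrite -val_eqE /=; lia.
- by apply: (range z q.-1) => //=; lia.
- by apply: (range z q) => //=; lia.
Qed.

Definition separator (q : 'I_N.+1) := split q || (w ord0 == ord0) && (q == 1%N :> nat).

(** The transposition of [j.-1] and [j] comes from the next split column above [j] or, if there is
    none, from the last one below. *)
Lemma range_tperm z (i j : 'I_N) : split z -> 0 < z -> i <= j ->
  (forall q : 'I_N.+1, i < q -> q <= j -> ~~ separator q) -> tperm i j \in H.
Proof.
move=> sz z0; have [n] := ubnP (j - i); elim: n j => // n IHn j jin ij ns.
have [->|ne] := ord_eqVneq i j; first by rewrite tperm1 group1.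
have jN : j < N.+1 by exact: ltnW (ltn_ord j).
have j1N : j.-1 < N by have := ltn_ord j; lia.
have := ns (Ordinal jN); rewrite /= negb_or leqnn => /(_ ltac:(lia) isT)/andP[nsj nj1].
have nj1' : w ord0 = ord0 -> nat_of_ord j <> 1%N.
  by move=> w0; apply/eqP; move: nj1; rewrite w0 eqxx.
apply: (@tperm_mem_trans _ _ _ (Ordinal j1N)).
  by apply: IHn => [/=|/=|q iq qj]; [lia|lia|apply: ns; rewrite /= in qj *; lia].
have [/existsP[y /andP[ys jy]]|/existsPn after] :=
    boolP [exists y : 'I_N.+1, split y && (j < y)].
  have [y' /andP[ys' jy'] yM] := @arg_minnP _ y [pred y : 'I_N.+1 | split y && (j < y)] val
    (introT andP (conj ys jy)).
  apply: (tperm_before_split ys' _ jy') => // [|r jr ry']; first by lia.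
  have [er|rj] := ord_eqVneq r (Ordinal jN); first by rewrite er.
  by apply/negP => sr; have := yM r; rewrite /= sr /= in rj * => /(_ ltac:(lia)); lia.
have zj : z < j.
  have := after z; rewrite sz /= -leqNgt => zj.
  by have [ez|/=] := ord_eqVneq z (Ordinal jN); [move: nsj; rewrite -ez sz|lia].
have [y' /andP[ys' jy'] yM] := @arg_maxnP _ z [pred y : 'I_N.+1 | split y && (y < j)] val
  (introT andP (conj sz zj)).
have zy' := yM z (introT andP (conj sz zj)).
apply: (tperm_after_split ys' _ jy') => // [|r yr rj]; first by rewrite /= in zy'; lia.
have [er|rj'] := ord_eqVneq r (Ordinal jN); first by rewrite er.
by apply/negP => sr; have := yM r; rewrite /= sr /= in rj' * => /(_ ltac:(lia)); lia.
Qed.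

Lemma split_one_mem z : split z -> 0 < z -> 1 \in H :* c.
Proof.
move=> sz z0; have [cz /eqP wz] := andP sz.
have zA : anchored z by apply: (cut_anchored cz); rewrite ?wz.
apply: (one_mem (del_mem zA)); apply: perm_mem_tperm => i.
(* [del z w] respects every separator. Deleting [z] shifts later columns down by one, so a split [q]
   beyond [z] enters through the cut at [q.+1]. *)
have sep_stable (q : 'I_N.+1) : separator q -> 0 < q ->
    forall k : 'I_N, k < q -> del z w k < q.
  move=> /orP[/andP[cq /eqP wq]|/andP[/eqP w0 /eqP q1]] q0 k kq.
    have cq1 : cut q.+1 by rewrite cut_fixed.
    have cz1 : cut z.+1 by rewrite cut_fixed.
    rewrite val_del wz; have [kz|zk] := ltnP k z.
      by have := cutP _ cq (lift z k); rewrite /= /bump /unbump; lia.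
    have := cutP _ cq1 (lift z k); have := @cut_col z.+1 (lift z k) cz1.
    by rewrite /= /bump /unbump; lia.
  have lk : lift z k = ord0 by apply: val_inj; rewrite /= /bump; lia.
  by rewrite val_del lk w0 wz /unbump /=; lia.
have [ile|ile] := leqP i (del z w i).
  apply: (range_tperm sz z0) => // q iq qi; apply/negP => sq.
  by have := sep_stable q sq (leq_ltn_trans (leq0n _) iq) i iq; lia.
rewrite tpermC; apply: (range_tperm sz z0) => [|q iq qi]; first exact: ltnW.
apply/negP => sq; have := perm_below (sep_stable q sq (leq_ltn_trans (leq0n _) iq)) iq.
by lia.
Qed.

Lemma one_mem_or_odd : 1 \in H :* c \/ forall x y, x < y -> odd_perm (minor x y w).
Proof.
have [/existsP[z /andP[sz z0]]|/existsPn ns] := boolP [exists z : 'I_N.+1, split z && (0 < z)].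
  by left; apply: split_one_mem sz z0.
have [/existsP[x /existsP[y /andP[xy ev]]]|/existsPn no] :=
  boolP [exists x : 'I_N.+1, exists y : 'I_N.+1, (x < y) && ~~ odd_perm (minor x y w)].
  left; apply: (unsplit_even_minor _ xy ev) => z z0.
  by have := ns z; rewrite z0 andbT.
right=> x y xy; have /existsPn/(_ y) := no x.
by rewrite xy negbK.
Qed.

End Core.

(* What oddness of all minors says about an even permutation. *)
Definition crossed n (v : 'S_n) := forall x y : 'I_n, x < y ->
  (v x < v y -> odd y (+) odd (v y)) /\ (v y < v x -> ~~ (odd y (+) odd (v x))).

Lemma odd_minors N (w : 'S_N.+1) :
  (forall x y : 'I_N.+1, x < y -> odd_perm (minor x y w)) ->
  ~~ odd_perm w /\ crossed w.
Proof.
move=> odd_m.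
have om (x y : 'I_N.+1) : x < y -> (w x < w y -> odd_perm w (+) odd y (+) odd (w y)) /\
    (w y < w x -> ~~ odd_perm w (+) odd y (+) odd (w x)).
  move=> xy; have := odd_m x y xy; rewrite /minor.
  case: ltngtP => [wxy|wyx|/val_inj/perm_inj exy] //.
    by rewrite odd_del; split.
  rewrite odd_del odd_permM odd_tperm permM tpermR => odd_xy; split=> // _; move: odd_xy.
  by have -> : x != y by apply: contraTneq xy => ->; rewrite ltnn.
(* The largest moved point [p] is inverted with the column of value [p]; in the parity of that minor
   the two contributions of [p] cancel. *)
have w_even : ~~ odd_perm w.
  have [x0 /= wx0|fix_w] := pickP [pred x | w x != x]; last first.
    rewrite (_ : w = 1%g) ?odd_perm1 //.
    by apply/permP => x; rewrite perm1; apply/eqP/negbFE/fix_w.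
  have [p /= wp pM] := @arg_maxnP _ x0 [pred x | w x != x] val wx0.
  pose a := w^-1%g p; have wa : w a = p by rewrite permKV.
  have ap : a != p by apply: contraNneq wp => eap; rewrite -{1}eap wa.
  have ap' : a < p.
    rewrite ltn_neqAle val_eqE ap; apply: pM => /=.
    by rewrite wa eq_sym.
  have wpp : w p < p.
    rewrite ltn_neqAle val_eqE wp; apply: pM => /=.
    by rewrite (inj_eq perm_inj).
  have [_] := om a p ap'; rewrite wa => /(_ wpp).
  by case: (odd p); case: odd_perm.
split=> // x y xy; have [] := om x y xy.
by rewrite (negbTE w_even); case: (odd y); case: (odd (w y)); case: (odd (w x)).
Qed.

(** Pairing with column [0] keeps the top value out of the last column, and pairing with column [n]
    keeps it from standing earlier than [n]. Value [n] is then last, or its column would form a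
    forbidden inversion with the last one. *)
Lemma crossed_top n (v : 'S_n.+2) : crossed v ->
  v (inord n) = ord_max /\ v ord_max = inord n.
Proof.
move=> cv; pose e := @inord n.+1 n; have en : e = n :> nat by rewrite inordK.
have vmax p y : v p = ord_max -> y != p -> v y < v p.
  move=> vp yp; have : v y != v p by rewrite (inj_eq perm_inj).
  by rewrite vp -val_eqE /=; have := ltn_ord (v y); lia.
have ve : v e = ord_max.
  pose p := v^-1%g ord_max; have vp : v p = ord_max by rewrite permKV.
  have [ep|pmax] := ord_eqVneq p ord_max.
    have [//|noninv _] := cv ord0 ord_max.
    have := vmax p ord0 vp; rewrite ep => /(_ isT)/noninv.
    by rewrite -{2}ep vp /= addbb.
  have [ep|pe] := ord_eqVneq p e; first by rewrite -ep.
  have pe' : p < e by rewrite en; have := ltn_ord p; rewrite /= in pmax; lia.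
  have [_ inv] := cv p e pe'; have /inv : v e < v p.
    by apply: vmax => //; rewrite -val_eqE /=; apply/eqP => ee; apply: pe.
  by rewrite vp /= en addbN addbb.
split=> //; pose a := v^-1%g e; have va : v a = e by rewrite permKV.
have [ea|amax] := ord_eqVneq a ord_max; first by rewrite -ea.
have amax' : a < (ord_max : 'I_n.+2) by have := ltn_ord a; rewrite /= in amax *; lia.
have [_ inv] := cv a ord_max amax'; move: inv; rewrite va en /= addNb addbb.
have : v ord_max != v a by rewrite (inj_eq perm_inj) -val_eqE /=; apply/eqP => /esym.
have : v ord_max != v e.
  by rewrite (inj_eq perm_inj) -val_eqE /= en; lia.
rewrite ve va -!val_eqE /= en; have := ltn_ord (v ord_max).
by move=> ? ? ? /(_ ltac:(lia)).
Qed.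

(** Removing the swapped top pair leaves a crossed permutation, so [v] is a product of [n./2]
    disjoint transpositions. *)
Lemma crossed_odd n (v : 'S_n) : crossed v -> odd_perm v = odd n./2.
Proof.
have [m] := ubnP n; elim: m n v => // m IHm [|[|n]] v nm cv.
- by rewrite (_ : v = 1%g) ?odd_perm1 //; apply/permP => -[].
- by rewrite (_ : v = 1%g) ?odd_perm1 //; apply/permP => x; rewrite !ord1.
have [ve vmax] := crossed_top cv.
have en : @inord n.+1 n = n :> nat by rewrite inordK.
pose v1 := del ord_max v; pose v2 := del ord_max v1.
have v1top : v1 ord_max = ord_max.
  apply: val_inj; rewrite /= val_del vmax en.
  have -> : lift ord_max ord_max = @inord n.+1 n.
    by apply: val_inj; rewrite /= en /bump; lia.
  by rewrite ve /unbump /=; lia.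
have v2E (k : 'I_n) : v2 k = v (widen_ord (leqW (leqnSn n)) k) :> nat.
  have lk : lift ord_max (lift ord_max k) = widen_ord (leqW (leqnSn n)) k.
    by apply: val_inj; rewrite /= /bump; have := ltn_ord k; lia.
  rewrite val_del v1top val_del vmax en lk /=.
  set x := widen_ord _ _.
  have : v x != v ord_max by rewrite (inj_eq perm_inj) -val_eqE /=; have := ltn_ord k; lia.
  have : v x != v (inord n).
    by rewrite (inj_eq perm_inj) -val_eqE /= en; have := ltn_ord k; lia.
  rewrite ve vmax -!val_eqE /= en; have := ltn_ord (v x); rewrite /unbump.
  by lia.
have odd_v : odd_perm v = ~~ odd_perm v2.
  have := odd_del ord_max v; have := odd_del ord_max v1.
  rewrite -/v1 -/v2 v1top vmax en /=.
  by case: (odd n); case: (odd_perm v); case: (odd_perm v1); case: (odd_perm v2).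
rewrite odd_v (IHm n v2) //=; first by rewrite ltnW // ltnW.
move=> x y xy; have [] := cv (widen_ord (leqW (leqnSn n)) x) (widen_ord (leqW (leqnSn n)) y) xy.
by rewrite -!v2E.
Qed.

(** * Functions of the order of first occurrence *)
Lemma ofo_seq_dup (T : eqType) (z : T) (s1 s2 : seq T) : z \in s1 ->
  ofo_seq (s1 ++ z :: s2) = ofo_seq (s1 ++ s2).
Proof.
move=> zs1; rewrite /ofo_seq !rev_cat rev_cons cat_rcons; congr rev.
have : z \in rev s1 by rewrite mem_rev.
move: (rev s1) (rev s2) => u t zu; elim: t => /= [|x t IHt]; first by rewrite zu.
by rewrite IHt !mem_cat inE; case: eqP => // ->; rewrite zu orbT.
Qed.

Lemma ofo_seq_uniq (T : eqType) (s : seq T) : uniq s -> ofo_seq s = s.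
Proof. by move=> us; rewrite /ofo_seq undup_id ?rev_uniq ?revK. Qed.

Lemma map_lift_enum n (j : 'I_n.+1) :
  map (lift j) (enum 'I_n) = take j (enum 'I_n.+1) ++ drop j.+1 (enum 'I_n.+1).
Proof.
apply: (inj_map val_inj); rewrite map_cat map_take map_drop val_enum_ord -map_comp.
rewrite (eq_map (g := bump j \o val)) // map_comp val_enum_ord.
have jn : j <= n by rewrite -ltnS.
have e : iota 0 n = iota 0 j ++ iota j (n - j).
  by rewrite -[X in iota X (n - j)]add0n -iotaD subnKC.
rewrite take_iota drop_iota /= e map_cat; congr (_ ++ _).
  rewrite (minn_idPl _) 1?ltnW //; apply: map_id_in => i.
  by rewrite mem_iota /bump => /andP[_ ij]; rewrite leqNgt ij.
rewrite add0n subSS -(add1n j) iotaDl; apply/eq_in_map => i.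
by rewrite mem_iota /bump => /andP[-> _].
Qed.

Lemma ofo_seq_lift (T : eqType) n (phi : 'I_n.+1 -> T) (i j : 'I_n.+1) :
  i < j -> phi i = phi j ->
  ofo_seq [seq phi k | k <- enum 'I_n.+1] = ofo_seq [seq phi (lift j k) | k <- enum 'I_n].
Proof.
move=> ij eij; have jn : j < size (enum 'I_n.+1) by rewrite size_enum_ord.
rewrite (map_comp phi (lift j)) map_lift_enum map_cat.
rewrite -{1}(cat_take_drop j (enum 'I_n.+1)) (drop_nth j jn) nth_ord_enum map_cat /=.
rewrite ofo_seq_dup // -eij map_f //.
have <- : nth i (take j (enum 'I_n.+1)) i = i by rewrite nth_take ?nth_ord_enum.
by rewrite mem_nth // size_take jn.
Qed.

Lemma ofo_minor (T : eqType) n (w : 'S_n.+1) (x y : 'I_n.+1) (b : 'I_n.+1 -> T) :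
  x < y -> b x = b y ->
  ofo_seq [seq b (w^-1 i) | i <- enum 'I_n.+1] =
  ofo_seq [seq b (lift y ((minor x y w)^-1 i)) | i <- enum 'I_n].
Proof.
move=> xy bxy; rewrite /minor; set v := (if _ then _ else _).
have bv c : b (w^-1 (v c)) = b c.
  rewrite /v; case: ifP => _; rewrite ?permM permK //.
  by case: tpermP => // ->.
have vxy : v x < v y.
  rewrite /v; case: (ltngtP (w x) (w y)) => // [|/val_inj/perm_inj exy].
    by rewrite !permM tpermL tpermR.
  by rewrite exy ltnn in xy.
rewrite (ofo_seq_lift vxy) ?bv //; congr ofo_seq; apply: eq_map => i.
by rewrite -{1}(permKV (del y v) i) lift_del bv.
Qed.

(** * Permutations matching two functions *)

Section Relation.

Variables (A : eqType) (B : Type) (F G : seq A -> B).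

(* In the notation of the paper [w] is the inverse of the permutation acting on
   the argument of [G]; then identifying arguments acts on [w] by [minor]. *)
Definition matched m (w : 'S_m) := forall a : 'I_m -> A,
  F (ofo_seq [seq a i | i <- enum 'I_m]) = G (ofo_seq [seq a (w^-1 i) | i <- enum 'I_m]).

Lemma matched_minor n (w : 'S_n.+1) (x y : 'I_n.+1) :
  x < y -> matched w -> matched (minor x y w).
Proof.
move=> xy mw a; have x0 : x < n by have := ltn_ord y; lia.
pose b c := if unlift y c is Some k then a k else a (Ordinal x0).
have blift k : b (lift y k) = a k by rewrite /b liftK.
have bxy : b x = b y.
  have -> : x = lift y (Ordinal x0) by apply: val_inj; rewrite /= /bump; lia.
  by rewrite blift /b unlift_none.
have := mw b; rewrite (ofo_minor w xy bxy) (ofo_seq_lift xy bxy).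
by rewrite (eq_map blift) (eq_map (fun i => blift _)).
Qed.

Lemma matched_mulVmul m (u v w : 'S_m) :
  matched u -> matched v -> matched w -> matched (u * v^-1 * w).
Proof.
move=> mu mv mw a; pose a' i := a (u^-1 (v i)).
have -> : [seq a ((u * v^-1 * w)^-1 i) | i <- enum 'I_m] = [seq a' (w^-1 i) | i <- enum 'I_m].
  by apply: eq_map => i; rewrite /a' !invMg invgK !permM.
rewrite -(mw a') (mv a') (mu a); congr (G (ofo_seq _)); apply: eq_map => i.
by rewrite /a' permKV.
Qed.

Lemma matched_one_le k r : matched (1 : 'S_k) -> 0 < r -> r <= k -> matched (1 : 'S_r).
Proof.
move=> m1 r0; elim: k m1 => [|k IHk] m1; first by rewrite leqn0 => /eqP r0'; rewrite r0' in r0.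
rewrite leq_eqVlt => /predU1P[->//|rk]; apply: IHk => //.
have k0 : 0 < k by apply: leq_trans r0 _.
have := @matched_minor _ _ ord0 ord_max k0 m1.
have -> // : minor ord0 ord_max 1 = 1 :> 'S_k.
apply/permP => i; apply: val_inj; rewrite /= /minor !perm1 k0 val_del !perm1.
by rewrite /= bumpK.
Qed.

Lemma matched_core n (w : 'S_n.+1) : matched w ->
  matched (1 : 'S_n) \/ forall x y : 'I_n.+1, x < y -> odd_perm (minor x y w).
Proof.
move=> mw; case: n w mw => [|n] w mw.
  by right=> x y; rewrite !ord1.
pose c := minor ord0 ord_max w.
have mc : matched c by apply: matched_minor.
(* By [matched_mulVmul] this is a group, and the matched permutations are its right coset of [c]. *)
pose H := [set h : 'S_n.+1 | `[< matched (h * c) >]].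
have HP h : reflect (matched (h * c)) (h \in H) by rewrite inE; apply: asboolP.
have gH : group_set H.
  apply/group_setP; split=> [|g h /HP mg /HP mh]; apply/HP; first by rewrite mul1g.
  by have := matched_mulVmul mg mc mh; rewrite mulgK mulgA.
have HcP u : reflect (matched u) (u \in Group gH :* c).
  by rewrite mem_rcoset /=; have := HP (u * c^-1); rewrite mulgKV.
have [|/HcP|] := @one_mem_or_odd _ w (Group gH) c; [|by left|by right].
by move=> x y xy; apply/HcP/matched_minor.
Qed.

Lemma matched_descend m r (w : 'S_m) : 0 < r -> r <= m -> matched w ->
  exists u : 'S_r, matched u.
Proof.
move=> r0; elim: m w => [|m IHm] w; first by rewrite leqn0 => /eqP r0'; rewrite r0' in r0.
rewrite leq_eqVlt => /predU1P[->|rm] mw; first by exists w.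
have m0 : 0 < m by apply: leq_trans r0 _.
by apply: (IHm (minor ord0 ord_max w)) => //; apply: matched_minor.
Qed.

(** In the exceptional case [w] is even, yet has the parity of [k.+1./2], which is odd for these
    residues. *)
Lemma matched_one_mod4 k (w : 'S_k.+1) : k = 1 %[mod 4] \/ k = 2 %[mod 4] ->
  matched w -> matched (1 : 'S_k).
Proof.
move=> k4 /matched_core[//|/odd_minors[w_even /crossed_odd]].
rewrite (negbTE w_even) => ek; exfalso.
have [q [eq|eq]] : exists q, k = (4 * q + 1)%N \/ k = (4 * q + 2)%N by exists (k %/ 4); lia.
  have e : k.+1./2 = (2 * q + 1)%N by lia.
  by rewrite e oddD oddM in ek.
have e : k.+1./2 = (2 * q + 1)%N by lia.
by rewrite e oddD oddM in ek.
Qed.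

(** In the exceptional case [w] swaps the last two positions. Merging these gives a minor fixing its
    last position, so it is not crossed and the next merge succeeds. *)
Lemma matched_one_add2 k (w : 'S_k.+2) : 0 < k -> matched w -> matched (1 : 'S_k).
Proof.
move=> k0 mw; have [m1|/odd_minors[_ cw]] := matched_core mw.
  exact: matched_one_le m1 k0 _.
have [we wmax] := crossed_top cw.
have kk : (inord k : 'I_k.+2) = k :> nat by rewrite inordK.
have kmax : (inord k : 'I_k.+2) < (ord_max : 'I_k.+2) by rewrite kk.
have [//|/odd_minors[_ cu]] := matched_core (matched_minor kmax mw).
exfalso; case: k k0 w mw we wmax kk kmax cw cu => // k _ w mw we wmax kk kmax cw cu.
have [_ /(congr1 val)] := crossed_top cu.
rewrite /= inordK // /minor we wmax kk /= ltnNge leqnSn /= val_del permM tpermR we /=.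
have -> : lift ord_max ord_max = inord k.+1 :> 'I_k.+3.
  by apply: val_inj; rewrite /= kk /bump; lia.
by rewrite permM tpermL wmax kk /unbump; lia.
Qed.

End Relation.

(** * From decks to matched permutations *)

Lemma tuple_mapE (A : Type) m n (a : n.-tuple A) (s : 'I_m -> 'I_n) :
  tuple_map a s = [seq tnth a (s i) | i <- enum 'I_m] :> seq A.
Proof. by []. Qed.

Lemma enum_nth (A : Type) (x0 : A) (s : seq A) :
  [seq nth x0 s (i : 'I_(size s)) | i <- enum 'I_(size s)] = s.
Proof.
rewrite (map_comp (nth x0 s) val) val_enum_ord.
by rewrite map_nth_iota0 // take_size.
Qed.

Lemma eq_deck (A B : Type) n (f g : n.-tuple A -> B) : 1 < n -> deck f = deck g ->
  exists I J : pairset n, fun_equiv (id_minor f I) (id_minor g J).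
Proof.
move=> n1 /eq_seq_msetP/perm_mem fg; have n0 : 0 < n := ltnW n1.
have cardI : #|[set Ordinal n0; Ordinal n1]| == 2 by rewrite cards2 -val_eqE.
pose I : pairset n := exist _ [set Ordinal n0; Ordinal n1] cardI.
have : fun_class (id_minor f I) \in [seq fun_class (id_minor f J) | J <- enum {: pairset n}].
  by apply/mapP; exists I; rewrite ?mem_enum.
rewrite fg => /mapP[J _ eJ]; exists I, J.
have : fun_class (id_minor g J) (id_minor g J).
  by exists 1 => a; congr (id_minor g J _); apply: eq_from_tnth => i; rewrite tnth_mktuple perm1.
by rewrite -eJ.
Qed.

Lemma ofo_id_minor (A : eqType) n (I : pairset n.+1) (s : 'S_n.+1) :
  exists t : 'S_n, forall b : n.-tuple A,
    ofo_seq (tuple_map (tuple_map b (delta I)) s) =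
    ofo_seq [seq tnth b (t i) | i <- enum 'I_n].
Proof.
have [x [y [_ xy mE ME]]] := pair_minmaxP I.
exists (minor x y s^-1)^-1 => b.
have dlift k : delta I (lift y k) = k.
  by apply: val_inj; rewrite /= /delta_nat mE ME; case: ltngtP; rewrite /bump; lia.
have dxy : delta I x = delta I y.
  by apply: val_inj; rewrite /= /delta_nat mE ME xy ltnn eqxx.
have := @ofo_minor _ n s^-1 x y (fun i => tnth b (delta I i)) xy.
rewrite dxy => /(_ erefl); rewrite invgK => e.
have -> : tuple_map (tuple_map b (delta I)) s =
    [seq tnth b (delta I (s i)) | i <- enum 'I_n.+1] :> seq A.
  by rewrite tuple_mapE; apply: eq_map => i; rewrite tnth_mktuple.
rewrite e.
by congr ofo_seq; apply: eq_map => i; rewrite dlift.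
Qed.

Theorem proposition8p1 (n k : nat) (n_gt0 : 0 < n) (k_gt0 : 0 < k)
  (n_large :
     (k = 1 %[mod 4] \/ k = 2 %[mod 4]) /\ k + 2 <= n \/
     (k = 0 %[mod 4] \/ k = 3 %[mod 4]) /\ k + 3 <= n)
  (A : finType) (B : Type)
  (A_ge2 : 2 <= #|A|) (B_ge2 : exists b1 b2 : B, b1 <> b2)
  (card_A : #|A| = k)
  (f g : n.-tuple A -> B)
  (f_ofo : weakly_determined_by_ofo n_gt0 f)
  (g_ofo : weakly_determined_by_ofo n_gt0 g) :
  deck f = deck g -> fun_equiv f g.
Proof.
case: n => [//|n] in n_gt0 n_large f g f_ofo g_ofo *.
move=> /eq_deck-/(_ ltac:(lia)) [I [J [p fIgJ]]].
case: B_ge2 => b0 _; case: f_ofo => fs [s1 fE]; case: g_ofo => gs [s2 gE].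
(* The default [b0] is taken only on sequences that are empty or have repetitions. *)
pose F s := if insub s is Some u then fs u else b0.
pose G s := if insub s is Some u then gs u else b0.
have {}fE a : f a = F (ofo_seq (tuple_map a s1)).
  by rewrite fE /F insubT; [exact: ofo_subproof | move=> ?; congr fs; apply: val_inj].
have {}gE a : g a = G (ofo_seq (tuple_map a s2)).
  by rewrite gE /G insubT; [exact: ofo_subproof | move=> ?; congr gs; apply: val_inj].
have [t1 t1E] := @ofo_id_minor A n I s1.
have [t2 t2E] := @ofo_id_minor A n J s2.
have mn : matched F G (t2 * p * t1^-1)^-1.
  move=> a; have := fIgJ [tuple a (t1^-1 i) | i < n].
  rewrite /id_minor fE gE t1E t2E.
  congr (F (ofo_seq _) = G (ofo_seq _)); apply: eq_map => i.
    by rewrite tnth_mktuple permK.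
  by rewrite !tnth_mktuple invgK !permM.
have mk : matched F G (1 : 'S_k).
  case: n_large => -[k4 kn].
    have [|u mu] := matched_descend (ltn0Sn k) _ mn; first by lia.
    exact: matched_one_mod4 mu.
  have [|u mu] := matched_descend (ltn0Sn k.+1) _ mn; first by lia.
  exact: matched_one_add2 mu.
exists (s2^-1 * s1) => a; rewrite fE gE.
have -> : tuple_map (tuple_map a (s2^-1 * s1)) s2 = tuple_map a s1.
  by apply: eq_from_tnth => i; rewrite !tnth_mktuple permM permK.
(* [F] and [G] agree on [s]: it has at most [k] letters, and as a word without repetitions it is its
   own order of first occurrence. *)
set s := ofo_seq _; have us : uniq s by rewrite rev_uniq undup_uniq.
have s0 : 0 < size s by case/andP: (ofo_subproof n_gt0 (tuple_map a s1)).
have sk : size s <= k by rewrite -card_A -(card_uniqP us) max_card.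
have x0 : A by case: (s) s0 => // x.
have := matched_one_le mk s0 sk (fun i => nth x0 s i).
rewrite enum_nth invg1 (eq_map (fun i => congr1 (fun j => nth x0 s (val j)) (perm1 i))).
by rewrite enum_nth ofo_seq_uniq.
Qed.
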